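(* Let $d\ge 1$, $\nu>0$, $\sigma>0$. Let $\mathbf{X}$ be a centered Gaussian random vector in $\mathbb{R}^d$ with covariance matrix $\sigma^2 I_d$, and let $\mathbf{T}$ be a random vector in $\mathbb{R}^d$, independent of $\mathbf{X}$, with the Student density $f_\nu(\mathbf{t})=A_{\nu,d}(1+\Vert\mathbf{t}\Vert^2)^{-\nu-\frac d2}$, where $A_{\nu,d}=\frac{\Gamma(\nu+\frac d2)}{\Gamma(\nu)\pi^{d/2}}$. Set $\gamma=\frac{1}{\sigma\sqrt2}$. Then the density of $\mathbf{Z}=\mathbf{X}+\mathbf{T}$ is \[ f_{\mathbf{Z}}(\mathbf{z})=\sum_{k=0}^{\infty}\alpha_k^{(\nu,\gamma)}g_{k,\sigma}(\mathbf{z}),\qquad \mathbf{z}\in\mathbb{R}^d, \] where \[ \alpha_k^{(\nu,\gamma)}=\frac{\Gamma(k+\frac d2)}{k!\,\Gamma(\frac d2)\Gamma(\nu)}\gamma^{2k}\int_0^{\infty}e^{-a}a^{\nu+\frac d2-1}(a+\gamma^2)^{-k-\frac d2}\,da,\qquad k\ge 0, \] are positive coefficients with $\sum_{k\ge0}\alpha_k^{(\nu,\gamma)}=1$.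
   Context: For $k\in\mathbb{N}$ and $\sigma>0$, $g_{k,\sigma}$ is the probability density on $\mathbb{R}^d$ \[ g_{k,\sigma}(\mathbf{z})=\frac{\Gamma(\frac d2)}{\Gamma(k+\frac d2)(\sigma\sqrt{2\pi})^d}\left(\frac{\Vert\mathbf{z}\Vert^2}{2\sigma^2}\right)^k\exp\left(-\frac{\Vert\mathbf{z}\Vert^2}{2\sigma^2}\right). \] The Student density $f_\nu$ corresponds to $2\nu$ degrees of freedom. *)

(* Defs.v *)
From HB Require Import structures.
From mathcomp Require Import all_boot all_order all_algebra.
From mathcomp Require Import all_classical all_reals all_analysis.
Set Implicit Arguments. Unset Strict Implicit. Unset Printing Implicit Defensive.
Import Order.TTheory GRing.Theory Num.Theory.
Import numFieldNormedType.Exports.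
Local Open Scope classical_set_scope.
Local Open Scope ring_scope.

Section Defs.
Variable R : realType.

Definition Gamma (s : R) : R :=
  fine (\int[@lebesgue_measure R]_(x in `]0%R, +oo[) ((x `^ (s - 1)) * expR (- x))%:E)%E.

Definition sqnorm (d : nat) (v : 'rV[R]_d) : R := \sum_(i < d) (v ord0 i) ^+ 2.

Definition borel_Rd (d : nat) : set (set 'rV[R]_d) :=
  <<s [set A | exists (i : 'I_d) (B : set R),
          measurable B /\ A = (fun v : 'rV[R]_d => v ord0 i) @^-1` B] >>.

(* Integral over R^d w.r.t. Lebesgue measure of a nonnegative function,
   as the iterated integral over the coordinates (Tonelli). *)
Fixpoint int_Rd (d : nat) : ('rV[R]_d -> \bar R) -> \bar R :=
  match d return ('rV[R]_d -> \bar R) -> \bar R with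
  | 0 => fun g => g 0
  | d'.+1 => fun g =>
      (\int[@lebesgue_measure R]_x int_Rd (fun v : 'rV[R]_d' =>
          g (row_mx (x%:M : 'rV[R]_1) v)))%E
  end.

Definition random_vector {dO} (Omega : measurableType dO) (d : nat)
    (X : Omega -> 'rV[R]_d) : Prop :=
  forall i : 'I_d, measurable_fun setT (fun w => X w ord0 i).

Definition indep_rv {dO} (Omega : measurableType dO) (P : probability Omega R)
    (d : nat) (X Y : Omega -> 'rV[R]_d) : Prop :=
  forall A B, borel_Rd A -> borel_Rd B ->
    P (X @^-1` A `&` Y @^-1` B) = (P (X @^-1` A) * P (Y @^-1` B))%E.

Definition has_density {dO} (Omega : measurableType dO) (P : probability Omega R)
    (d : nat) (X : Omega -> 'rV[R]_d) (f : 'rV[R]_d -> \bar R) : Prop :=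
  forall A, borel_Rd A ->
    P (X @^-1` A) = int_Rd (fun x => ((\1_A x)%:E * f x)%E).

Definition gauss_density (d : nat) (sigma : R) (x : 'rV[R]_d) : R :=
  (sigma * Num.sqrt (2 * pi)) ^- d * expR (- (sqnorm x / (2 * sigma ^+ 2))).

(* Student density f_nu (2 nu degrees of freedom). *)
Definition student_A (nu : R) (d : nat) : R :=
  Gamma (nu + d%:R / 2) / (Gamma nu * pi `^ (d%:R / 2)).
Definition student_density (d : nat) (nu : R) (t : 'rV[R]_d) : R :=
  student_A nu d * (1 + sqnorm t) `^ (- nu - d%:R / 2).

Definition g_ks (d : nat) (k : nat) (sigma : R) (z : 'rV[R]_d) : R :=
  Gamma (d%:R / 2) / (Gamma (k%:R + d%:R / 2) * (sigma * Num.sqrt (2 * pi)) ^+ d)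
  * (sqnorm z / (2 * sigma ^+ 2)) ^+ k * expR (- (sqnorm z / (2 * sigma ^+ 2))).

Definition alpha (d : nat) (nu gamma : R) (k : nat) : R :=
  Gamma (k%:R + d%:R / 2) / (k`!%:R * Gamma (d%:R / 2) * Gamma nu) * gamma ^+ (2 * k)
  * fine (\int[@lebesgue_measure R]_(a in `]0%R, +oo[)
           (expR (- a) * a `^ (nu + d%:R / 2 - 1)
            * (a + gamma ^+ 2) `^ (- k%:R - d%:R / 2))%:E)%E.

End Defs.

(* Main.v *)
(** The Student density is a Gamma mixture of Gaussian profiles:
    [Gamma(s) (1 + |t|^2)^(-s)] is the integral over [a > 0] of
    [a^(s-1) e^(-a) e^(-a |t|^2)], with [s = nu + d/2].  Put [p = gamma^2].
    Convolving [e^(-p |x|^2)] with [e^(-a |t|^2)] gives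
    [(pi / (a + p))^(d/2) e^(-p |z|^2) e^(p^2 |z|^2 / (a + p))];
    expanding the last exponential in power series and integrating term by term
    in [a] (everything is nonnegative) yields the series of the statement.  The
    weights sum to [1] by the negative binomial series for [p / (a + p)], itself
    obtained by integrating an exponential series against [t^(s-1) e^(-t)]. *)
Require Import Defs.
From HB Require Import structures.
From mathcomp Require Import all_boot all_order all_algebra.
From mathcomp Require Import all_classical all_reals all_analysis.
From mathcomp Require Import measurable_realfun.
From mathcomp Require Import ring.
Set Implicit Arguments. Unset Strict Implicit. Unset Printing Implicit Defensive.
Import Order.TTheory GRing.Theory Num.Theory.
Import numFieldNormedType.Exports.
Local Open Scope classical_set_scope.
Local Open Scope ring_scope.

(** * Lebesgue measure on R^d *)

(** The convolution of the two Gaussian profiles carries the factor exp(- a p |z|^2 / (a + p)),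
    whose own power series alternates. Since a p / (a + p) = p - p^2 / (a + p), taking out exp(- p
    |z|^2) leaves a positive exponent: this is the origin of the densities g_k and of positive
    weights, and it is why monotone convergence suffices to sum under the integral. Two obstacles
    shape the development. [int_Rd] is an iterated integral attached to no measure, whereas
    independence and the exchanges of integrals call for product measures. And the statement is
    about real numbers, with [fine] in [Gamma] and [alpha] and [limn] for the series: the identities
    are proved in the extended reals and brought back by finiteness bounds. *)

Lemma image_measure d1 d2 (T1 : measurableType d1) (T2 : measurableType d2)
    (R : realType) (mu : {measure set T1 -> \bar R}) (f : T1 -> T2) :
  measurable_fun setT f ->
  exists nu : {measure set T2 -> \bar R},
    (forall A, nu A = mu (f @^-1` A)) /\
    (forall g : T2 -> \bar R, measurable_fun setT g -> (forall y, 0 <= g y)%E ->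
      (\int[nu]_y g y = \int[mu]_x g (f x))%E).
Proof.
move=> mf.
(* The pushforward is a measure only by virtue of [mf]; the existential form keeps that proof out of
   later statements. *)
unshelve eexists [the measure _ _ of pushforward mu f]; first exact: mf.
split=> // g mg g0.
by rewrite ge0_integral_pushforward.
Qed.

Lemma sigma_finite_measure_of d (T : measurableType d) (R : realType)
    (mu : {measure set T -> \bar R}) : sigma_finite setT mu ->
  exists nu : {sigma_finite_measure set T -> \bar R},
    (nu : set T -> \bar R) = mu.
Proof.
case: mu => m [mc mm] sf.
have s := sfinite_measure_sigma_finite sf.
by exists (SigmaFiniteMeasure.Pack (SigmaFiniteMeasure.Class mm
  (isSFinite.Build _ _ _ m s) (isSigmaFinite.Build _ _ _ m sf))).
Qed.

(** The generator that [borel_Rd] contains, named so that it can index a measurable type.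
    Measurability there is [borel_Rd] by conversion, so [has_density] and [indep_rv] apply directly
    to measurable sets. *)
Definition coord_cylinders (R : realType) (d : nat) : set (set 'rV[R]_d) :=
  [set A | exists (i : 'I_d) (B : set R),
     measurable B /\ A = (fun v : 'rV[R]_d => v ord0 i) @^-1` B].

(* ['rV[R]_d] carrying the sigma-algebra [borel_Rd]. *)
Notation rVborel R d := (g_sigma_algebraType (@coord_cylinders R d)).

Section row_vectors.
Context {R : realType}.
Local Notation mu := (@lebesgue_measure R).

Lemma measurable_coord d (i : 'I_d) :
  measurable_fun setT (fun v : rVborel R d => (v : 'rV[R]_d) ord0 i).
Proof.
move=> _ B mB; rewrite setTI; apply: sub_sigma_algebra.
by exists i, B.
Qed.

Lemma measurable_fun_rowP d dT (T : measurableType dT) (f : T -> rVborel R d) :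
  measurable_fun setT f <->
  forall i, measurable_fun setT (fun t => (f t : 'rV[R]_d) ord0 i).
Proof.
split=> [mf i|mf].
  exact: (measurableT_comp (measurable_coord i) mf).
apply: (@measurability _ _ T (rVborel R d) setT f (@coord_cylinders R d)) => //.
move=> _ [_ [i [B [mB ->]]] <-].
exact: mf.
Qed.

(** The [row_mx] of [int_Rd], uncurried into a map out of a product space, so that its measurability
    can be stated and Tonelli applied to it. *)
Definition cons_rV d (p : R * rVborel R d) : rVborel R d.+1 :=
  row_mx (p.1%:M : 'rV[R]_1) (p.2 : 'rV[R]_d).

Lemma cons_rV0 d (p : R * rVborel R d) : cons_rV p ord0 ord0 = p.1.
Proof.
have -> : ord0 = lshift d (ord0 : 'I_1) by apply: val_inj.
by apply: etrans (row_mxEl _ _ _ _) _; rewrite mxE mulr1n.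
Qed.

Lemma cons_rVS d (p : R * rVborel R d) (i : 'I_d) :
  cons_rV p ord0 (lift ord0 i) = (p.2 : 'rV[R]_d) ord0 i.
Proof.
have -> : lift ord0 i = rshift 1 i by apply: val_inj.
exact: row_mxEr.
Qed.

Lemma cons_rVD d (x y : R) (v w : rVborel R d) :
  cons_rV (x + y, (v : 'rV[R]_d) + (w : 'rV[R]_d)) =
  (cons_rV (x, v) : 'rV[R]_d.+1) + (cons_rV (y, w) : 'rV[R]_d.+1).
Proof.
apply/rowP => i; rewrite [RHS]mxE; case: (unliftP ord0 i) => [j|] ->.
  by rewrite !cons_rVS mxE.
by rewrite !cons_rV0.
Qed.

Lemma cons_rVK d (v : rVborel R d.+1) :
  cons_rV ((v : 'rV[R]_d.+1) ord0 ord0,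
    \row_i (v : 'rV[R]_d.+1) ord0 (lift ord0 i)) = v.
Proof.
apply/rowP => i; case: (unliftP ord0 i) => [j|] ->.
  by rewrite cons_rVS mxE.
by rewrite cons_rV0.
Qed.

Lemma measurable_cons_rV d : measurable_fun setT (@cons_rV d).
Proof.
apply/measurable_fun_rowP => i; case: (unliftP ord0 i) => [j|] ->.
  under eq_fun do rewrite cons_rVS.
  exact: (measurableT_comp (measurable_coord j)).
under eq_fun do rewrite cons_rV0.
exact: measurable_fst.
Qed.

Lemma int_Rd_cons d (g : 'rV[R]_d.+1 -> \bar R) :
  int_Rd g = (\int[mu]_x int_Rd (fun v : 'rV[R]_d => g (cons_rV (x, v))))%E.
Proof. by []. Qed.

Lemma eq_int_Rd d (f g : 'rV[R]_d -> \bar R) : f =1 g -> int_Rd f = int_Rd g.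
Proof. by move=> /funext ->. Qed.

(* [int_Rd] is only an iterated integral; realising it as integration against a
   sigma-finite measure makes Tonelli's theorem available on R^d. *)
Lemma exists_lebesgue_rV d :
  exists m : {sigma_finite_measure set rVborel R d -> \bar R},
    forall g : rVborel R d -> \bar R, measurable_fun setT g ->
      (forall v, 0 <= g v)%E -> (\int[m]_v g v = int_Rd g)%E.
Proof.
elim: d => [|d [m IH]].
  exists (@dirac _ (rVborel R 0) (0 : 'rV[R]_0) R) => g mg g0.
  by rewrite integral_dirac// diracT mul1e.
pose u (v : rVborel R d.+1) : measurableTypeR R * rVborel R d :=
  ((v : 'rV[R]_d.+1) ord0 ord0,
   (\row_i (v : 'rV[R]_d.+1) ord0 (lift ord0 i) : 'rV[R]_d)).
have uK : cancel (@cons_rV d) u.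
  move=> [x v]; rewrite /u cons_rV0; congr pair.
  by apply/rowP => i; rewrite mxE cons_rVS.
have mu_ : measurable_fun setT u.
  apply/measurable_fun_pairP; split; first exact: measurable_coord.
  apply/measurable_fun_rowP => i; rewrite /u/=.
  under eq_fun do rewrite mxE.
  exact: measurable_coord.
(* The measure in dimension d + 1 is the image of the product measure under [cons_rV]. *)
have [k [kE kint]] := image_measure (mu \x m)%E (@measurable_cons_rV d).
have sf : sigma_finite setT k.
  have /sigma_finiteP[F [TF ndF Foo]] := sigma_finiteT mu.
  have /sigma_finiteP[G [TG ndG Goo]] := sigma_finiteT m.
  (* An image of a sigma-finite measure need not be sigma-finite; here the measurable inverse [u]
     transports an exhaustion by boxes. Both sequences increase, so the larger of two indices serves
     both coordinates. *)
  exists (fun n => u @^-1` (F n `*` G n)).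
    rewrite -preimage_bigcup.
    rewrite (_ : \bigcup_i (F i `*` G i) = setT) ?preimage_setT//.
    rewrite -subTset => -[x v] _.
    have [n _ Fnx] : (\bigcup_n F n) x by rewrite -TF.
    have [p _ Gpv] : (\bigcup_n G n) v by rewrite -TG.
    exists (maxn n p) => //; split => /=.
      by move: x Fnx; exact/subsetPset/ndF/leq_maxl.
    by move: v Gpv; exact/subsetPset/ndG/leq_maxr.
  move=> n; have [mFn Fnoo] := Foo n; have [mGn Gnoo] := Goo n; split.
    by rewrite -[X in measurable X]setTI; apply: mu_ => //; exact: measurableX.
  rewrite kE -comp_preimage (_ : u \o _ = id) ?preimage_id; last first.
    by apply/funext => p; exact: uK.
  by rewrite /= product_measure1E// lte_mul_pinfty// ge0_fin_numE.
have [k' k'E] := sigma_finite_measure_of sf.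
exists k' => g mg g0; rewrite k'E.
rewrite kint// int_Rd_cons fubini_tonelli1//=; last first.
  exact: (measurableT_comp mg (@measurable_cons_rV d)).
apply: eq_integral => x _; rewrite /fubini_F IH//.
apply: (measurableT_comp mg).
exact: (measurableT_comp (@measurable_cons_rV d) (measurable_pair1 x)).
Qed.

End row_vectors.

(** * Affine substitutions and convolution of densities *)

Section affine.
Context {R : realType}.
Local Notation mu := (@lebesgue_measure R).

(** By uniqueness of Lebesgue measure: [a] times the image of [mu] under x -> a x + b agrees with
    [mu] on the intervals ]c, d]. *)
Lemma ge0_integral_affine (a b : R) (g : R -> \bar R) : 0 < a ->
  measurable_fun setT g -> (forall x, 0 <= g x)%E ->
  (\int[mu]_x g x = a%:E * \int[mu]_x g (a * x + b)%R)%E.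
Proof.
move=> a0 mg g0.
have mf : measurable_fun (setT : set (measurableTypeR R))
    (fun x => a * x + b : measurableTypeR R).
  by apply: measurable_funD => //; exact: measurable_funM.
have [nu [nuE nuint]] := image_measure mu mf.
pose an : {nonneg R} := NngNum (ltW a0).
rewrite -nuint// -(@ge0_integral_mscale _ _ _ _ setT measurableT an)//.
apply: eq_measure_integral => A mA _.
apply: lebesgue_measure_unique => //= _ [[c d]] _ <-.
have E : (fun x : R => a * x + b) @^-1` `]c, d]%classic =
    `](c - b) / a, (d - b) / a]%classic.
  apply/seteqP; split => x /=; rewrite !in_itv/= ltr_pdivrMr// ler_pdivlMr//;
    by rewrite ltrBlDr lerBrDr mulrC.
have muE : mu ((fun x : R => a * x + b) @^-1` `]c, d]%classic) =
    (if (c - b) / a < (d - b) / a then ((d - b) / a - (c - b) / a)%:E else 0%:E).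
  by rewrite E; apply: etrans (lebesgue_measure_itv _) _; rewrite /= lte_fin.
apply: etrans (lebesgue_measure_itv _) _; rewrite /= lte_fin /mscale/= nuE.
apply: etrans; last exact: (congr1 (fun x => a%:E * x)%E (esym muE)).
rewrite ltr_pM2r ?invr_gt0// ltrD2r.
case: ifPn => _; last by rewrite mule0.
by rewrite -!EFinB -EFinM; congr EFin; field; rewrite gt_eqF.
Qed.

End affine.

Section lebesgue_rV.
Context {R : realType}.
Local Notation mu := (@lebesgue_measure R).

Definition lebesgue_rV d : {sigma_finite_measure set rVborel R d -> \bar R} :=
  sval (cid (@exists_lebesgue_rV R d)).

Lemma integral_lebesgue_rV d (g : rVborel R d -> \bar R) :
  measurable_fun setT g -> (forall v, 0 <= g v)%E ->
  (\int[lebesgue_rV d]_v g v = int_Rd g)%E.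
Proof. exact: (svalP (cid (@exists_lebesgue_rV R d))). Qed.

Lemma measurable_int_Rd d dT (T : measurableType dT)
    (F : T * rVborel R d -> \bar R) :
  measurable_fun setT F -> (forall p, 0 <= F p)%E ->
  measurable_fun setT (fun t => int_Rd (fun v : 'rV[R]_d => F (t, v))).
Proof.
move=> mF F0.
rewrite (_ : (fun t => _) = fubini_F (lebesgue_rV d) F).
  exact: measurable_fun_fubini_tonelli_F.
apply/funext => t; rewrite /fubini_F integral_lebesgue_rV//.
exact: (measurableT_comp mF (measurable_pair1 t)).
Qed.

Lemma int_Rd_ge0 d (g : 'rV[R]_d -> \bar R) :
  (forall v, 0 <= g v)%E -> (0 <= int_Rd g)%E.
Proof.
elim: d g => [|d IH] g g0 /=; first exact: g0.
by apply: integral_ge0 => x _; exact: IH.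
Qed.

(** Serves the substitution z = x + t in the convolution. Each coordinate is translated separately,
    by [ge0_integral_affine] with slope 1. *)
Lemma int_Rd_shift d (c : 'rV[R]_d) (g : rVborel R d -> \bar R) :
  measurable_fun setT g -> (forall v, 0 <= g v)%E ->
  int_Rd (fun v : 'rV[R]_d => g (v + c)) = int_Rd g.
Proof.
elim: d c g => [|d IH] c g mg g0.
  by apply: eq_int_Rd => v; rewrite (thinmx0 c) addr0.
rewrite !int_Rd_cons -(cons_rVK c).
set x := c ord0 ord0; set w : rVborel R d := \row_i _.
have mgc : measurable_fun setT (fun p => g (cons_rV p)).
  exact: (measurableT_comp mg (@measurable_cons_rV R d)).
pose H y : \bar R := int_Rd (fun v : 'rV[R]_d => g (cons_rV (y, v))).
have mH : measurable_fun setT H by exact: (measurable_int_Rd mgc).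
have H0 y : (0 <= H y)%E by exact: int_Rd_ge0.
rewrite [RHS](@ge0_integral_affine _ 1 x)// mul1e.
apply: eq_integral => y _; rewrite mul1r -/(H _) /H.
rewrite -(IH w (fun v => g (cons_rV (y + x, v))))//.
  by apply: eq_int_Rd => v; rewrite cons_rVD.
exact: (measurableT_comp mgc (measurable_pair1 _)).
Qed.

End lebesgue_rV.

(** Makes a measure of a density, so that uniqueness of the product measure can be applied to it. *)
Lemma density_measure d (T : measurableType d) (R : realType)
    (mu : {measure set T -> \bar R}) (f : T -> \bar R) :
  measurable_fun setT f -> (forall x, 0 <= f x)%E ->
  exists nu : {measure set T -> \bar R},
    forall A, (nu A = \int[mu]_(x in A) f x)%E.
Proof.
move=> mf f0; pose k (A : set T) := (\int[mu]_(x in A) f x)%E.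
have k0 : k set0 = 0%E by rewrite /k integral_set0.
have k_ge0 A : (0 <= k A)%E by exact: integral_ge0.
have ks : semi_sigma_additive k.
  move=> F mF tF mUF; rewrite /k ge0_integral_bigcup//; last first.
    exact: measurable_funTS.
  by apply: is_cvg_ereal_nneg_natsum_cond => n _ _; exact: integral_ge0.
by exists (HB.pack_for {measure set T -> \bar R} k
  (isMeasure.Build _ _ _ k k0 k_ge0 ks)).
Qed.

Section density_convolution.
Context {R : realType} (d : nat) (dO : measure_display)
  (Omega : measurableType dO) (P : probability Omega R).
Local Open Scope ereal_scope.

(** The joint law [J] of (X, T) equals the measure [D] of density f(x) g(t), so the law of X + T is
    [D] on the preimage of [A] under addition; Tonelli and a translation then isolate the variable
    z. *)
Lemma density_convolution (X T : Omega -> 'rV[R]_d)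
    (f g : rVborel R d -> \bar R) :
  measurable_fun setT f -> (forall v, 0 <= f v) ->
  measurable_fun setT g -> (forall v, 0 <= g v) ->
  random_vector X -> random_vector T ->
  has_density P X f -> has_density P T g -> indep_rv P X T ->
  has_density P (fun w => X w + T w)%R
    (fun z => int_Rd (fun t : 'rV[R]_d => f (z - t)%R * g t)).
Proof.
move=> mf f0 mg g0 rX rT dX dT indep.
have mX : measurable_fun setT (X : Omega -> rVborel R d).
  exact/measurable_fun_rowP.
have mT : measurable_fun setT (T : Omega -> rVborel R d).
  exact/measurable_fun_rowP.
have mD : measurable_fun setT (fun p : rVborel R d * rVborel R d =>
    ((p.1 : 'rV[R]_d) + (p.2 : 'rV[R]_d))%R : rVborel R d).
  apply/measurable_fun_rowP => i; under eq_fun do rewrite mxE.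
  by apply: measurable_funD; apply: (measurableT_comp (measurable_coord i)).
have mB : measurable_fun setT (fun p : rVborel R d * rVborel R d =>
    ((p.1 : 'rV[R]_d) - (p.2 : 'rV[R]_d))%R : rVborel R d).
  apply/measurable_fun_rowP => i; under eq_fun do rewrite !mxE.
  by apply: measurable_funB; apply: (measurableT_comp (measurable_coord i)).
pose L := lebesgue_rV (R := R) d.
have [m1 [m1E _]] := image_measure P mX.
have [m2 [m2E _]] := image_measure P mT.
have sf (m : {measure set rVborel R d -> \bar R}) : m setT < +oo ->
    sigma_finite setT m.
  by move=> mfin; exists (fun=> setT) => //; rewrite bigcup_const.
have [n1 n1E] : exists n : {sigma_finite_measure set rVborel R d -> \bar R},
    (n : set _ -> \bar R) = m1.
  apply: sigma_finite_measure_of; apply: sf.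
  rewrite m1E preimage_setT.
  by apply: (le_lt_trans (probability_le1 P measurableT)); rewrite ltry.
have [n2 n2E] : exists n : {sigma_finite_measure set rVborel R d -> \bar R},
    (n : set _ -> \bar R) = m2.
  apply: sigma_finite_measure_of; apply: sf.
  rewrite m2E preimage_setT.
  by apply: (le_lt_trans (probability_le1 P measurableT)); rewrite ltry.
have mXT : measurable_fun setT
    (fun w => (X w, T w) : rVborel R d * rVborel R d).
  exact/measurable_fun_pairP.
have [J [JE _]] := image_measure P mXT.
have mfg : measurable_fun setT
    (fun p : rVborel R d * rVborel R d => f p.1 * g p.2).
  by apply: emeasurable_funM;
    [exact: (measurableT_comp mf)|exact: (measurableT_comp mg)].
have fg0 (p : rVborel R d * rVborel R d) : 0 <= f p.1 * g p.2.
  exact: mule_ge0.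
have [D DE] := density_measure (L \x L) mfg fg0.
have mI (A : set (rVborel R d)) : measurable A ->
    measurable_fun setT (fun x : rVborel R d => (\1_A x : R)%:E).
  by move=> mA; apply/measurable_EFinP/measurable_indic.
have I0 (A : set (rVborel R d)) x : 0 <= (\1_A x : R)%:E by rewrite lee_fin.
have mIM (A : set (rVborel R d)) h : measurable A -> measurable_fun setT h ->
    measurable_fun setT (fun x : rVborel R d => (\1_A x : R)%:E * h x).
  by move=> mA mh; apply: emeasurable_funM => //; exact: mI.
(* Uniqueness on rectangles is used twice: independence identifies [J] with the product of the
   marginal laws, and the two densities identify that product with [D]. *)
have JD C : measurable C -> J C = D C.
  move=> mC; transitivity ((n1 \x n2) C).
    apply/esym/product_measure_unique => // A B mA mB'.
    by rewrite JE n1E n2E m1E m2E -indep.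
  apply: product_measure_unique => // A B mA mB'.
  rewrite DE n1E n2E m1E m2E.
  pose F (x : rVborel R d) := (\1_A x : R)%:E * f x.
  pose G (x : rVborel R d) := (\1_B x : R)%:E * g x.
  have mF : measurable_fun setT F by exact: mIM.
  have mG : measurable_fun setT G by exact: mIM.
  have F0 x : 0 <= F x by exact: mule_ge0.
  have G0 x : 0 <= G x by exact: mule_ge0.
  transitivity (int_Rd F * int_Rd G); last first.
    by congr (_ * _); [exact/esym/dX|exact/esym/dT].
  rewrite -(integral_lebesgue_rV mF)// -(integral_lebesgue_rV mG)//.
  transitivity (\int[L \x L]_p (F p.1 * G p.2)).
    rewrite integral_mkcond; apply: eq_integral => -[x y] _.
    rewrite epatch_indic/= /F /G !indicE in_setX/=.
    by case: (x \in A); case: (y \in B);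
      rewrite /= ?(mule1, mule0, mul1e, mul0e).
  rewrite fubini_tonelli1//=; last 2 first.
  - by apply: emeasurable_funM;
    [exact: (measurableT_comp mF)|exact: (measurableT_comp mG)].
  - by move=> p; exact: mule_ge0.
  under eq_integral do rewrite /fubini_F/= ge0_integralZl//.
  by rewrite ge0_integralZr//; exact: integral_ge0.
move=> A mA.
have mS : measurable ((fun p : rVborel R d * rVborel R d =>
    ((p.1 : 'rV[R]_d) + (p.2 : 'rV[R]_d))%R : rVborel R d) @^-1` A).
  by rewrite -[X in measurable X]setTI; exact: mD.
transitivity (D ((fun p : rVborel R d * rVborel R d =>
    ((p.1 : 'rV[R]_d) + (p.2 : 'rV[R]_d))%R : rVborel R d) @^-1` A)).
  by rewrite -JD// JE.
(* [K] is the integrand in the variables (z, t), [H] below the same one in (x, t); at fixed t they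
   differ by the translation z = x + t. *)
pose K (p : rVborel R d * rVborel R d) :=
  (\1_A p.1 : R)%:E * (f ((p.1 : 'rV[R]_d) - (p.2 : 'rV[R]_d))%R * g p.2).
have mK : measurable_fun setT K.
  apply: emeasurable_funM; first exact: (measurableT_comp (mI A mA)).
  by apply: emeasurable_funM;
    [exact: (measurableT_comp mf)|exact: (measurableT_comp mg)].
have K0 p : 0 <= K p by rewrite mule_ge0// mule_ge0.
have fubK : \int[L]_t \int[L]_z K (z, t) = \int[L]_z \int[L]_t K (z, t).
  by rewrite fubini_tonelli.
pose H (p : rVborel R d * rVborel R d) :=
  (\1_A ((p.1 : 'rV[R]_d) + (p.2 : 'rV[R]_d))%R : R)%:E * (f p.1 * g p.2).
have mH : measurable_fun setT H.
  apply: emeasurable_funM; last exact: mfg.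
  exact: (measurableT_comp (mI A mA) mD).
have H0 p : 0 <= H p by apply: mule_ge0; [exact: I0|exact: fg0].
transitivity (\int[L]_t \int[L]_z K (z, t)).
  rewrite DE integral_mkcond; transitivity (\int[L \x L]_p H p).
    by apply: eq_integral => p _; rewrite epatch_indic /H muleC.
  rewrite (fubini_tonelli2 H mH H0).
  apply: eq_integral => t _; rewrite /fubini_G.
  have mKt : measurable_fun setT (fun z => K (z, t)).
    exact: (measurableT_comp mK (measurable_pair2 t)).
  have K0t z : 0 <= K (z, t) by exact: K0.
  have mHt : measurable_fun setT (fun z => H (z, t)).
    exact: (measurableT_comp mH (measurable_pair2 t)).
  have H0t z : 0 <= H (z, t) by exact: H0.
  rewrite (integral_lebesgue_rV mKt K0t) (integral_lebesgue_rV mHt H0t).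
  rewrite -(int_Rd_shift (t : 'rV[R]_d) mKt K0t).
  by apply: eq_int_Rd => x; rewrite /K /H/= addrK.
have mKz : measurable_fun setT (fun z => \int[L]_t K (z, t)).
  exact: (measurable_fun_fubini_tonelli_F K mK K0).
have Kz0 z : 0 <= \int[L]_t K (z, t) by apply: integral_ge0 => t _; exact: K0.
rewrite fubK (integral_lebesgue_rV mKz Kz0).
apply: eq_int_Rd => z.
have mBz : measurable_fun setT (fun t : rVborel R d =>
    ((z : 'rV[R]_d) - (t : 'rV[R]_d))%R : rVborel R d).
  exact: (measurableT_comp mB (measurable_pair1 (z : rVborel R d))).
have mz : measurable_fun setT
    (fun t : rVborel R d => f ((z : 'rV[R]_d) - (t : 'rV[R]_d))%R * g t).
  apply: emeasurable_funM; last exact: mg.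
  exact: (measurableT_comp mf mBz).
have z0 t : 0 <= f ((z : 'rV[R]_d) - (t : 'rV[R]_d))%R * g t by exact: mule_ge0.
rewrite -(integral_lebesgue_rV mz z0).
exact: (ge0_integralZl L measurableT mz (fun t _ => z0 t) (I0 A z)).
Qed.

End density_convolution.

(** * The Gamma function *)

Section gamma.
Context {R : realType}.
Local Notation mu := (@lebesgue_measure R).
Implicit Types (s b x t : R).

Lemma nneseries_exp x : 0 <= x ->
  (\sum_(k <oo) (x ^+ k / k`!%:R)%:E = (expR x)%:E)%E.
Proof.
move=> x0; rewrite /expR -EFin_lim; last exact: is_cvg_series_exp_coeff.
by apply/congr_lim/funext => n /=; rewrite /series/= -sumEFin.
Qed.

(** If the integral vanished, [f] would be zero almost everywhere, and the half line, of infinite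
    measure, would lie in a null set. *)
Lemma integral0y_gt0 (f : R -> R) :
  measurable_fun (`]0, +oo[%classic : set R) f ->
  (forall x, 0 < x -> 0 < f x) ->
  (0 < \int[mu]_(x in `]0%R, +oo[) (f x)%:E)%E.
Proof.
move=> mf f0.
have f0' x : `]0, +oo[%classic x -> (0 <= (f x)%:E)%E.
  by rewrite /= in_itv/= andbT => x0; rewrite lee_fin ltW// f0.
rewrite lt0e integral_ge0// andbT; apply/eqP => fI0.
have mD : measurable (`]0, +oo[%classic : set R) by [].
have I0 : (\int[mu]_(x in `]0%R, +oo[) `|(EFin \o f) x| = 0)%E.
  by rewrite -[RHS]fI0; apply: eq_integral => x /set_mem /f0' /gee0_abs.
have mEf : measurable_fun (`]0, +oo[%classic : set R) (EFin \o f).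
  exact/measurable_EFinP.
have [A [mA A0 DA]] := (ae_eq_integral_abs mu mD mEf).1 I0.
have : (mu `]0%R, +oo[ <= mu A)%E.
  apply: le_measure; rewrite ?inE// => x /= xD; apply: DA => /= /(_ xD).
  by case=> /eqP; rewrite gt_eqF// f0//; move: xD; rewrite in_itv/= andbT.
by rewrite A0 lebesgue_measure_itv/= ltry addye.
Qed.

Lemma ge0_integral0y_scale b (g : R -> \bar R) : 0 < b ->
  measurable_fun (`]0, +oo[%classic : set R) g ->
  (forall x, (0 < x)%R -> (0 <= g x)%E) ->
  (\int[mu]_(x in `]0%R, +oo[) g x =
   b%:E * \int[mu]_(x in `]0%R, +oo[) g (b * x)%R)%E.
Proof.
move=> b0 mg g0; rewrite integral_mkcond (@ge0_integral_affine _ b 0)//.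
- congr (_ * _)%E; rewrite [RHS]integral_mkcond; apply: eq_integral => x _.
  by rewrite addr0 !patchE !mem_setE !in_itv/= !andbT pmulr_rgt0.
- exact/(measurable_restrictT _ _).1.
- move=> x; apply: erestrict_ge0 => {}x /=.
  by rewrite in_itv/= andbT; exact: g0.
Qed.

(* The integrand is singular at [0] when [s < 1], so the fundamental theorem of
   calculus is applied on [[1/(n+2), 1]] before passing to the limit. *)
Lemma integral01_powR_le s : 0 < s ->
  (\int[mu]_(x in `]0%R, 1%R]) (x `^ (s - 1))%:E <= (s^-1)%:E)%E.
Proof.
move=> s0; pose F n : set R := `[n.+2%:R^-1, 1]%classic.
have UF : `]0, 1]%classic = \bigcup_n F n.
  apply/seteqP; split => x /=.
    rewrite in_itv/= => /andP[x0 x1].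
    exists (Num.truncn x^-1) => //.
    rewrite /F/= in_itv/= x1 andbT invf_ple ?posrE//.
    apply/ltW/(lt_trans (truncnS_gt _)).
    by rewrite ltr_nat.
  move=> [n _]; rewrite /F/= !in_itv/= => /andP[xn ->]; rewrite andbT.
  by apply: lt_le_trans xn; rewrite invr_gt0.
have mp D : measurable_fun D (fun x : R => (x `^ (s - 1))%:E).
  by apply/measurable_funTS/measurable_EFinP; exact: measurable_powR.
have ndF : nondecreasing_seq F.
  move=> m n mn; apply/subsetPset => x; rewrite /F/= !in_itv/= => /andP[xm ->].
  by rewrite andbT (le_trans _ xm)// lef_pV2 ?posrE// ler_nat.
have cv : (\int[mu]_(x in F i) (x `^ (s - 1))%:E @[i --> \oo] -->
    \int[mu]_(x in `]0%R, 1%R]) (x `^ (s - 1))%:E)%E.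
  rewrite UF; apply: ge0_nondecreasing_set_cvg_integral => //.
  - by move=> i; exact: measurable_itv.
  - by move=> i; exact: mp.
  - by move=> i x _; rewrite lee_fin powR_ge0.
apply: (cvge_to_le cv).
apply: nearW => n.
  have n0 : 0 < (n.+2%:R^-1 : R) by rewrite invr_gt0.
  have n1 : (n.+2%:R^-1 : R) < 1 by rewrite invf_lt1// ltr1n.
  have pos x : n.+2%:R^-1 <= x -> 0 < x by exact: lt_le_trans.
  rewrite (@continuous_FTC2 _ _ (fun x => s^-1 * x `^ s))//.
  + rewrite -EFinB lee_fin powR1 mulr1 lerBlDr lerDl mulr_ge0// ?powR_ge0//.
    by rewrite invr_ge0 ltW.
  + apply: derivable_within_continuous => x.
    rewrite in_itv/= => /andP[/pos x0 _].
    by apply: derivable_powR; rewrite in_itv/= x0.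
  + have dF x : 0 < x -> derivable (fun x => s^-1 * x `^ s) x 1.
      move=> x0; apply: derivableM => //.
      by apply: derivable_powR; rewrite in_itv/= x0.
    have cF x : 0 < x -> {for x, continuous (fun x : R => s^-1 * x `^ s)}.
      by move=> x0; apply/differentiable_continuous/derivable1_diffP/dF.
    split.
    * move=> x; rewrite in_itv/= => /andP[/ltW/pos x0 _]; exact: dF.
    * by apply: cvg_at_right_filter; exact: cF.
    * by apply: cvg_at_left_filter; exact: cF.
  + move=> x; rewrite in_itv/= => /andP[/ltW/pos x0 _].
    have [dd dE] := is_derive1_powR s x0.
    rewrite derive1E deriveM//= derive_cst scaler0 addr0 dE.
    by rewrite /GRing.scale/= mulrA mulVf ?mul1r// gt_eqF.
Qed.

Lemma measurable_powR_expR s b (D : set R) :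
  measurable_fun D (fun x : R => x `^ s * expR (- (b * x))).
Proof.
apply: measurable_funTS; apply: measurable_funM; first exact: measurable_powR.
apply: measurableT_comp; first exact: measurable_expR.
by apply: measurableT_comp => //; exact: measurable_funM.
Qed.

Lemma measurable_gamma_integrand s (D : set R) :
  measurable_fun D (fun x : R => x `^ (s - 1) * expR (- x)).
Proof.
by have := @measurable_powR_expR (s - 1) 1 D; under eq_fun do rewrite mul1r.
Qed.

Lemma gamma_integrand_le s : exists2 C : R, 0 <= C &
  forall x, 1 <= x -> x `^ (s - 1) * expR (- x) <= C * exponential_pdf 2^-1 x.
Proof.
(* For x >= 1, x^(s-1) <= x^(n+1) <= (n+1)! 2^(n+1) e^(x/2), the last step being one term of the
   exponential series at x/2. The leading 2 cancels the rate in the density. *)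
pose n := (Num.truncn s); exists (2 * (n.+1`!%:R * 2 ^+ n.+1)).
  by rewrite !mulr_ge0// exprn_ge0.
move=> x x1; have x0 : 0 <= x := le_trans ler01 x1.
rewrite exponential_pdfE// mulNr.
have -> : 2 * (n.+1`!%:R * 2 ^+ n.+1) * (2^-1 * expR (- (2^-1 * x))) =
    n.+1`!%:R * 2 ^+ n.+1 * expR (2^-1 * x) * expR (- x) :> R.
  rewrite (_ : - x = - (2^-1 * x) + - (2^-1 * x)); last by field.
  have eK : expR (2^-1 * x) * expR (- (2^-1 * x)) = 1.
    by rewrite -expRD subrr expR0.
  by rewrite expRD [RHS]mulrA -[X in _ = X * _]mulrA eK mulr1; field.
rewrite ler_wpM2r ?expR_ge0//.
apply: (@le_trans _ _ (x `^ n.+1%:R)).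
  apply: ler_powR => //; apply: (@le_trans _ _ s); first by rewrite gerBl.
  exact/ltW/truncnS_gt.
rewrite powR_mulrn// -ler_pdivrMl; last first.
  by rewrite mulr_gt0// ?exprn_gt0// ltr0n fact_gt0.
apply: le_trans (expR_ge1Dxn n _); last by rewrite mulr_ge0.
rewrite [leLHS](_ : _ = (2^-1 * x) ^+ n.+1 / n.+1`!%:R) ?lerDr//.
by rewrite exprMn exprVn invfM -mulrA mulrC.
Qed.

Lemma integral_Gamma_lty s : 0 < s ->
  (\int[mu]_(x in `]0%R, +oo[) (x `^ (s - 1) * expR (- x))%:E < +oo)%E.
Proof.
move=> s0; have f0 x : 0 <= x `^ (s - 1) * expR (- x).
  by rewrite mulr_ge0 ?powR_ge0 ?expR_ge0.
have mf D : measurable_fun D (fun x : R => (x `^ (s - 1) * expR (- x))%:E).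
  by apply/measurable_EFinP; exact: measurable_gamma_integrand.
(* On ]0, 1] the exponential is at most 1 and the power has integral at most 1/s; beyond 1 the
   exponential bound takes over. *)
have -> : `]0, +oo[%classic = `]0, 1] `|` `]1, +oo[ :> set R.
  apply/seteqP; split => x /=; rewrite !in_itv/= ?andbT.
    by move=> ->; have [x1|x1] := leP x 1; [left|right].
  move=> [/andP[]//|]; exact: lt_trans.
rewrite ge0_integral_setU//=; last 3 first.
- exact: mf.
- by move=> x _; rewrite lee_fin.
- apply/disj_setPLR => x /=; rewrite !in_itv/= andbT => /andP[_ x1].
  by apply/negP; rewrite -leNgt.
rewrite lte_add_pinfty//.
  apply: le_lt_trans (ltry s^-1); apply: le_trans (integral01_powR_le s0).
  apply: ge0_le_integral => //=.
  - by move=> x _; rewrite lee_fin.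
  - exact: mf.
  - by apply/measurable_EFinP; apply: measurable_funTS; exact: measurable_powR.
  - move=> x; rewrite in_itv/= => /andP[x0 _].
    by rewrite lee_fin ler_piMr ?powR_ge0// -[leRHS]expR0 ler_expR oppr_le0 ltW.
have [C C0 fC] := gamma_integrand_le s.
have half_gt0 : 0 < (2^-1 : R) by [].
have me D : measurable_fun D (fun x : R => (exponential_pdf 2^-1 x)%:E).
  by apply/measurable_funTS/measurable_EFinP; exact: measurable_exponential_pdf.
have e0 x : (0 <= (exponential_pdf (2^-1 : R) x)%:E)%E.
  by rewrite lee_fin exponential_pdf_ge0.
apply: (@le_lt_trans _ _ (\int[mu]_x (C%:E * (exponential_pdf 2^-1 x)%:E)))%E.
  apply: (@le_trans _ _ (\int[mu]_(x in `]1%R, +oo[)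
      (C%:E * (exponential_pdf 2^-1 x)%:E))%E).
    apply: ge0_le_integral => //=.
    - by move=> x _; rewrite lee_fin.
    - exact: mf.
    - by apply: measurable_funeM; exact: me.
    - by move=> x; rewrite in_itv/= andbT => /ltW x1; rewrite -EFinM lee_fin fC.
  apply: ge0_subset_integral => //; first by apply: measurable_funeM; exact: me.
  by move=> x _; rewrite mule_ge0.
rewrite ge0_integralZl//; last exact: me.
by rewrite integral_exponential_pdf// mule1 ltry.
Qed.

(** [Gamma] is a [fine], which sends an infinite integral to 0; finiteness gives access to the
    integral itself. *)
Lemma integral_Gamma s : 0 < s ->
  (\int[mu]_(x in `]0%R, +oo[) (x `^ (s - 1) * expR (- x))%:E = (Gamma s)%:E)%E.
Proof.
move=> s0; rewrite /Gamma fineK// ge0_fin_numE ?integral_Gamma_lty//.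
by apply: integral_ge0 => x _; rewrite lee_fin mulr_ge0 ?powR_ge0 ?expR_ge0.
Qed.

Lemma Gamma_gt0 s : 0 < s -> 0 < Gamma s.
Proof.
move=> s0; rewrite -lte_fin -integral_Gamma//; apply: integral0y_gt0.
  exact: measurable_gamma_integrand.
by move=> x x0; rewrite mulr_gt0 ?powR_gt0 ?expR_gt0.
Qed.

Lemma integral_Gamma_scale s b : 0 < s -> 0 < b ->
  (\int[mu]_(x in `]0%R, +oo[) (x `^ (s - 1) * expR (- (b * x)))%:E =
   (Gamma s * b `^ (- s))%:E)%E.
Proof.
move=> s0 b0; rewrite EFinM -integral_Gamma//.
rewrite [in RHS](ge0_integral0y_scale b0); last 2 first.
- by apply/measurable_EFinP; exact: measurable_gamma_integrand.
- by move=> x _; rewrite lee_fin mulr_ge0 ?powR_ge0 ?expR_ge0.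
rewrite muleAC -EFinM -ge0_integralZl//=.
- apply: eq_integral => x; rewrite inE/= in_itv/= andbT => x0.
  rewrite -EFinM powRM ?ltW//; congr EFin.
  have : b `^ 1 * b `^ (- s) * b `^ (s - 1) = 1.
    rewrite -!powRD ?(gt_eqF b0) ?implybT//.
    by rewrite (_ : 1 + - s + (s - 1) = 0) ?powRr0//; ring.
  rewrite powRr1 ?ltW// => bE.
  by rewrite -[LHS]mul1r -{1}bE; ring.
- apply/measurable_EFinP/measurable_funTS.
  rewrite (_ : (fun _ => _) = (fun x => x `^ (s - 1) * expR (- x)) \o *%R b)//.
  by apply: measurableT_comp => //; exact: measurable_gamma_integrand.
- by move=> x _; rewrite lee_fin mulr_ge0 ?powR_ge0 ?expR_ge0.
- by rewrite lee_fin mulr_ge0 ?powR_ge0 ?ltW.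
Qed.

Lemma nneseries_negative_binomial s x : 0 < s -> 0 <= x < 1 ->
  (\sum_(k <oo) (Gamma (k%:R + s) / k`!%:R * x ^+ k)%:E =
   (Gamma s * (1 - x) `^ (- s))%:E)%E.
Proof.
(* The right side becomes a Gamma integral of rate 1 - x > 0, and e^(-(1-x)t) = e^(-t) e^(xt)
   supplies the series. *)
move=> s0 /andP[x0 x1]; rewrite -integral_Gamma_scale ?subr_gt0//.
pose f (k : nat) (t : R) : R :=
  t `^ (s - 1) * expR (- t) * ((x * t) ^+ k / k`!%:R).
have mf k (D : set R) : measurable_fun D (EFin \o f k).
  apply/measurable_EFinP/measurable_funM.
    exact: measurable_gamma_integrand.
  apply: measurable_funM => //; apply: measurable_funX.
  exact: measurable_funM.
have f0 k t : 0 < t -> (0 <= (f k t)%:E)%E.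
  move=> t0; rewrite lee_fin; apply: mulr_ge0.
    by rewrite mulr_ge0 ?powR_ge0 ?expR_ge0.
  by rewrite divr_ge0// exprn_ge0// mulr_ge0// ltW.
transitivity (\sum_(k <oo) \int[mu]_(t in `]0%R, +oo[) (f k t)%:E)%E.
  apply: eq_eseriesr => k _.
  have ks0 : 0 < k%:R + s by rewrite ltr_wpDl.
  rewrite mulrAC -mulrA mulrC EFinM -(integral_Gamma ks0) -ge0_integralZl//.
  - apply: eq_integral => t; rewrite inE/= in_itv/= andbT => t0.
    rewrite -EFinM; congr EFin; rewrite /f exprMn.
    rewrite (_ : k%:R + s - 1 = (s - 1) + k%:R); last by ring.
    by rewrite powRD ?(gt_eqF t0) ?implybT// powR_mulrn ?ltW//; ring.
  - by apply/measurable_EFinP; exact: measurable_gamma_integrand.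
  - by move=> t _; rewrite lee_fin mulr_ge0 ?powR_ge0 ?expR_ge0.
  - by rewrite lee_fin divr_ge0// exprn_ge0.
rewrite -integral_nneseries//; last 2 first.
- by move=> k; exact: mf.
- by move=> k t /=; rewrite in_itv/= andbT; exact: f0.
apply: eq_integral => t; rewrite inE/= in_itv/= andbT => t0.
under eq_eseriesr do rewrite /f EFinM.
rewrite nneseriesZl//; last first.
  by move=> k _; rewrite lee_fin divr_ge0// exprn_ge0// mulr_ge0// ltW.
have xt0 : 0 <= x * t by rewrite mulr_ge0// ltW.
rewrite nneseries_exp// -EFinM -mulrA -expRD.
by congr (_ * expR _)%:E; ring.
Qed.

End gamma.

(** * Gaussian integrals *)

Section gaussian.
Context {R : realType}.
Local Notation mu := (@lebesgue_measure R).
Implicit Types (a b c m p x z : R).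

Lemma integral_gauss c m : 0 < c ->
  (\int[mu]_x (expR (- (c * (x - m) ^+ 2)))%:E = (Num.sqrt (pi / c))%:E)%E.
Proof.
move=> c0; pose s := Num.sqrt (2 * c)^-1.
have c20 : 0 < (2 * c)^-1 by rewrite invr_gt0 mulr_gt0.
have s0 : s != 0 by rewrite gt_eqF// sqrtr_gt0.
have s2 : s ^+ 2 = (2 * c)^-1 by rewrite sqr_sqrtr// ltW.
have p0 := normal_peak_gt0 s0.
transitivity (\int[mu]_x ((normal_peak s)^-1%:E * (normal_pdf m s x)%:E))%E.
  apply: eq_integral => x _; rewrite normal_pdfE// -EFinM mulKf ?gt_eqF//.
  rewrite /normal_fun s2; congr (expR _)%:E; rewrite -mulr_natr.
  by field; rewrite gt_eqF.
rewrite ge0_integralZl//=.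
- rewrite integral_normal_pdf mule1 /normal_peak invrK s2; congr (Num.sqrt _)%:E.
  by rewrite -mulr_natr; field; rewrite gt_eqF.
- by apply/measurable_EFinP; exact: measurable_normal_pdf.
- by move=> x _; rewrite lee_fin normal_pdf_ge0.
- by rewrite lee_fin invr_ge0 ltW.
Qed.

(** Completing the square: p (z - x)^2 + a x^2 = (a + p) (x - p z / (a + p))^2 + a p / (a + p) z^2.
    The case a = 0 gives the plain Gaussian integral, needed for a finiteness bound. *)
Lemma integral_gauss_conv a p z : 0 < p -> 0 <= a ->
  (\int[mu]_x (expR (- (p * (z - x) ^+ 2)) * expR (- (a * x ^+ 2)))%:E =
   (Num.sqrt (pi / (a + p)) * expR (- (a * p / (a + p) * z ^+ 2)))%:E)%E.
Proof.
move=> p0 a0; have ap0 : 0 < a + p by rewrite ltr_wpDl.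
rewrite mulrC EFinM -(integral_gauss (p * z / (a + p)) ap0) -ge0_integralZl//=.
- apply: eq_integral => x _; rewrite -EFinM -!expRD; congr (expR _)%:E.
  by field; rewrite gt_eqF.
- apply/measurable_EFinP; apply: measurableT_comp; first exact: measurable_expR.
  apply: measurableT_comp => //; apply: measurable_funM => //.
  by apply: measurable_funX; exact: measurable_funB.
Qed.

Lemma sqnorm_ge0 d (v : 'rV[R]_d) : 0 <= sqnorm v.
Proof. by apply: sumr_ge0 => i _; exact: sqr_ge0. Qed.

Lemma sqnorm_cons d x (v : rVborel R d) :
  sqnorm (cons_rV (x, v) : 'rV[R]_d.+1) = x ^+ 2 + sqnorm (v : 'rV[R]_d).
Proof.
rewrite /sqnorm big_ord_recl cons_rV0; congr (_ + _).
by apply: eq_bigr => i _; rewrite cons_rVS.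
Qed.

(** The free factor [c] strengthens the induction: it absorbs the contribution of the first
    coordinate. *)
Lemma int_Rd_gauss_conv d a p c (z : 'rV[R]_d) : 0 < p -> 0 <= a -> 0 <= c ->
  int_Rd (fun t : 'rV[R]_d =>
    (c * (expR (- (p * sqnorm (z - t))) * expR (- (a * sqnorm t))))%:E) =
  (c * (Num.sqrt (pi / (a + p)) ^+ d *
     expR (- (a * p / (a + p) * sqnorm z))))%:E.
Proof.
move=> p0 a0; elim: d c z => [|d IH] c z c0.
  rewrite /= subr0 /sqnorm !big_ord0; congr (_ * _)%:E.
  by rewrite !mulr0 oppr0 expR0 expr0.
rewrite int_Rd_cons -(cons_rVK z).
set z0 := z ord0 ord0; set w : rVborel R d := \row_i _.
transitivity (\int[mu]_x
   ((c * (Num.sqrt (pi / (a + p)) ^+ d *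
      expR (- (a * p / (a + p) * sqnorm (w : 'rV[R]_d)))))%:E *
    (expR (- (p * (z0 - x) ^+ 2)) * expR (- (a * x ^+ 2)))%:E))%E.
  apply: eq_integral => x _.
  transitivity (int_Rd (fun t : 'rV[R]_d =>
    (c * (expR (- (p * (z0 - x) ^+ 2)) * expR (- (a * x ^+ 2))) *
      (expR (- (p * sqnorm ((w : 'rV[R]_d) - t))) *
       expR (- (a * sqnorm t))))%:E)).
    apply: eq_int_Rd => t; congr EFin.
    have -> : (cons_rV (z0, w) : 'rV[R]_d.+1) - cons_rV (x, t) =
        cons_rV (z0 - x, (w : 'rV[R]_d) - t).
      apply/rowP => i; rewrite [LHS]mxE [X in _ + X]mxE.
      by case: (unliftP ord0 i) => [j|] ->; rewrite ?cons_rVS ?cons_rV0// !mxE.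
    rewrite !sqnorm_cons !mulrDr !opprD !expRD; ring.
  rewrite IH; last by rewrite mulr_ge0// mulr_ge0 ?expR_ge0.
  by rewrite -EFinM mulrAC.
rewrite ge0_integralZl//=.
- rewrite integral_gauss_conv// -EFinM sqnorm_cons mulrDr opprD expRD.
  rewrite [_ ^+ d.+1]exprSr.
  have mACA (S1 E1 s1 e1 : R) :
      c * (S1 * E1) * (s1 * e1) = c * (S1 * s1 * (e1 * E1)).
    by ring.
  by rewrite mACA.
- apply/measurable_EFinP; apply: measurable_funM.
    apply: measurableT_comp; first exact: measurable_expR.
    apply: measurableT_comp => //; apply: measurable_funM => //.
    by apply: measurable_funX; exact: measurable_funB.
  apply: measurableT_comp; first exact: measurable_expR.
  apply: measurableT_comp => //; apply: measurable_funM => //.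
- by rewrite lee_fin !mulr_ge0 ?exprn_ge0 ?sqrtr_ge0 ?expR_ge0.
Qed.

Lemma measurable_sqnorm d : measurable_fun setT (@sqnorm R d : rVborel R d -> R).
Proof.
apply: measurable_sum => i; apply: measurable_funX; exact: measurable_coord.
Qed.

(** The passage from a finite sum in the extended reals to convergence of the real series. *)
Lemma cvg_series_EFin (u : nat -> R) (l : R) : (forall k, 0 <= u k) ->
  (\sum_(k <oo) (u k)%:E = l%:E)%E -> series u @ \oo --> l.
Proof.
move=> u0 ul.
have : (EFin \o series u) @ \oo --> l%:E.
  rewrite -ul (_ : EFin \o series u = fun n => \sum_(0 <= k < n) (u k)%:E)%E.
    by apply: is_cvg_nneseries => k _ _; rewrite lee_fin.
  by apply/funext => n; rewrite /= /series/= -sumEFin.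
by move/fine_cvgP => [].
Qed.

End gaussian.

(** * The Gaussian-Student mixture *)

Section mixture.
Context {R : realType} (d : nat) (nu p : R).
Hypotheses (d0 : (0 < d)%N) (nu0 : 0 < nu) (p0 : 0 < p).
Local Notation mu := (@lebesgue_measure R).
Local Notation q := (d%:R / 2 : R).
Local Notation s := (nu + d%:R / 2).

Let q0 : 0 < q. Proof. by rewrite divr_gt0// ltr0n. Qed.
Let s0 : 0 < s. Proof. by rewrite addr_gt0. Qed.

(** The integrand of [alpha] with [p] in place of gamma^2. *)
Definition alpha_integrand (k : nat) (a : R) : R :=
  expR (- a) * a `^ (s - 1) * (a + p) `^ (- k%:R - q).

Lemma measurable_alpha_integrand k (D : set R) :
  measurable_fun D (alpha_integrand k).
Proof.
apply: measurable_funTS; apply: measurable_funM; last first.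
  apply: (@measurableT_comp _ _ _ _ _ _ (@powR R ^~ _)) => //.
  exact: measurable_funD.
under eq_fun do rewrite mulrC.
exact: measurable_gamma_integrand.
Qed.

Lemma alpha_integrand_gt0 k a : 0 < a -> 0 < alpha_integrand k a.
Proof.
move=> a0; rewrite /alpha_integrand.
by rewrite !mulr_gt0 ?expR_gt0 ?powR_gt0// addr_gt0.
Qed.

Definition alpha_integral (k : nat) : R :=
  fine (\int[mu]_(a in `]0%R, +oo[) (alpha_integrand k a)%:E)%E.

Lemma alpha_integralE k :
  (\int[mu]_(a in `]0%R, +oo[) (alpha_integrand k a)%:E =
   (alpha_integral k)%:E)%E.
Proof.
rewrite /alpha_integral fineK// ge0_fin_numE; last first.
  apply: integral_ge0 => a /=; rewrite in_itv/= andbT => a0.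
  by rewrite lee_fin ltW// alpha_integrand_gt0.
(* The exponent is negative and a + p > p, so this constant bounds the last factor and a multiple of
   the integral of Gamma(s) dominates. *)
pose C := p `^ (- k%:R - q).
have mg (D : set R) :
    measurable_fun D (fun x : R => (x `^ (s - 1) * expR (- x))%:E).
  by apply/measurable_EFinP; exact: measurable_gamma_integrand.
apply: (@le_lt_trans _ _
  (\int[mu]_(a in `]0%R, +oo[) (C%:E * (a `^ (s - 1) * expR (- a))%:E))%E).
  apply: ge0_le_integral => //=.
  - move=> a; rewrite in_itv/= andbT => a0.
    by rewrite lee_fin ltW// alpha_integrand_gt0.
  - by apply/measurable_EFinP; exact: measurable_alpha_integrand.
  - by apply: measurable_funeM; exact: mg.
  - move=> a; rewrite in_itv/= andbT => a0.
    rewrite -EFinM lee_fin /alpha_integrand mulrC [expR _ * _]mulrC.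
    rewrite ler_wpM2r ?mulr_ge0 ?powR_ge0 ?expR_ge0// /C -opprD !powRN.
    rewrite lef_pV2 ?posrE ?powR_gt0// ?addr_gt0//.
    rewrite ge0_ler_powR ?nnegrE ?addr_ge0// ?ltW// ?ltrDr//.
rewrite ge0_integralZl//.
- by rewrite integral_Gamma// -EFinM ltry.
- exact: mg.
- by move=> x _; rewrite lee_fin mulr_ge0 ?powR_ge0 ?expR_ge0.
- by rewrite lee_fin powR_ge0.
Qed.

Lemma alpha_integral_gt0 k : 0 < alpha_integral k.
Proof.
rewrite -lte_fin -alpha_integralE; apply: integral0y_gt0.
  exact: measurable_alpha_integrand.
by move=> a; exact: alpha_integrand_gt0.
Qed.

(** The Student constant without its factor Gamma(s), which the mixture integral supplies. *)
Let c0 : R := (Gamma nu * pi `^ q)^-1.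
Let c0_ge0 : 0 <= c0.
Proof. by rewrite invr_ge0 mulr_ge0 ?powR_ge0// ltW// Gamma_gt0. Qed.

Lemma student_density_mixture (t : 'rV[R]_d) :
  ((student_density nu t)%:E = c0%:E *
   \int[mu]_(a in `]0%R, +oo[)
     (a `^ (s - 1) * expR (- ((1 + sqnorm t) * a)))%:E)%E.
Proof.
rewrite integral_Gamma_scale//; last by rewrite ltr_pwDl// sqnorm_ge0.
rewrite -EFinM /student_density /student_A -opprD.
by rewrite [in RHS]mulrA [c0 * _]mulrC.
Qed.

Lemma int_Rd_gauss_student (c : R) (z : 'rV[R]_d) : 0 <= c ->
  (int_Rd (fun t : 'rV[R]_d =>
     (c * expR (- (p * sqnorm (z - t))))%:E * (student_density nu t)%:E) =
   \int[mu]_(a in `]0%R, +oo[) (c * c0 * (a `^ (s - 1) * expR (- a)) *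
      (Num.sqrt (pi / (a + p)) ^+ d *
       expR (- (a * p / (a + p) * sqnorm z))))%:E)%E.
Proof.
move=> c_ge0; pose L := lebesgue_rV (R := R) d.
pose H0 (w : rVborel R d * R) : R := c * c0 * (w.2 `^ (s - 1) * expR (- w.2)) *
  (expR (- (p * sqnorm (z - w.1))) * expR (- (w.2 * sqnorm (w.1 : 'rV[R]_d)))).
(* The indicator extends the integral in a from the half line to the whole line, where Tonelli is
   applied. *)
pose H (w : rVborel R d * measurableTypeR R) : \bar R :=
  ((H0 w)%:E * (\1_(`]0, +oo[%classic : set R) w.2)%:E)%E.
have H0_ge0 w : 0 <= H0 w.
  by rewrite /H0 !mulr_ge0 ?powR_ge0 ?expR_ge0.
have H_ge0 w : (0 <= H w)%E by rewrite mule_ge0// lee_fin.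
have ms (f : rVborel R d * measurableTypeR R -> R) :
    measurable_fun setT f -> measurable_fun setT (fun w => expR (- f w)).
  move=> mf; apply: measurableT_comp; first exact: measurable_expR.
  exact: measurableT_comp.
have mzt : measurable_fun setT (fun w : rVborel R d * measurableTypeR R =>
    sqnorm (z - (w.1 : 'rV[R]_d))).
  apply: measurable_sum => i; apply: measurable_funX.
  under eq_fun do rewrite !mxE.
  apply: measurable_funB => //.
  exact: (measurableT_comp (measurable_coord i) measurable_fst).
have mH0 : measurable_fun setT H0.
  apply: measurable_funM.
    apply: measurable_funM => //.
    exact: (measurableT_comp
      (@measurable_gamma_integrand R s setT) measurable_snd).
  apply: measurable_funM; first by apply: ms; exact: measurable_funM.
  apply: ms; apply: measurable_funM; first exact: measurable_snd.
  exact: (measurableT_comp (@measurable_sqnorm R d) measurable_fst).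
have mH : measurable_fun setT H.
  apply: emeasurable_funM; first exact/measurable_EFinP.
  have mi : measurable_fun setT
      (\1_(`]0, +oo[%classic : set R) : measurableTypeR R -> R).
    exact: measurable_indic.
  by apply/measurable_EFinP; exact: (measurableT_comp mi measurable_snd).
have HE t : (\int[mu]_a H (t, a) =
    \int[mu]_(a in `]0%R, +oo[) (H0 (t, a))%:E)%E.
  rewrite [RHS]integral_mkcond; apply: eq_integral => a _.
  by rewrite epatch_indic.
have mHF : measurable_fun setT (fun t : rVborel R d => \int[mu]_a H (t, a))%E.
  exact: (measurable_fun_fubini_tonelli_F H mH H_ge0).
have HF0 t : (0 <= \int[mu]_a H (t, a))%E by exact: integral_ge0.
transitivity (int_Rd (fun t : 'rV[R]_d => \int[mu]_a H (t, a))%E).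
  apply: eq_int_Rd => t; rewrite HE student_density_mixture.
  rewrite muleA -EFinM -ge0_integralZl//.
  - apply: eq_integral => a _; rewrite -EFinM /H0/=; congr EFin.
    rewrite (_ : (1 + sqnorm t) * a = a + a * sqnorm t); last by ring.
    by rewrite opprD expRD; ring.
  - by apply/measurable_EFinP; exact: measurable_powR_expR.
  - by move=> a _; rewrite lee_fin mulr_ge0 ?powR_ge0 ?expR_ge0.
  - by rewrite lee_fin !mulr_ge0 ?expR_ge0.
rewrite -(integral_lebesgue_rV mHF HF0) (fubini_tonelli H mH H_ge0).
rewrite [RHS]integral_mkcond; apply: eq_integral => a _.
rewrite patchE; case: ifPn => [|aD].
  rewrite inE/= in_itv/= andbT => a0.
  rewrite -(int_Rd_gauss_conv z p0 (ltW a0)); last first.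
    by rewrite !mulr_ge0 ?powR_ge0 ?expR_ge0.
  have mHa : measurable_fun setT (fun t => H (t, a)).
    exact: (measurableT_comp mH (measurable_pair2 a)).
  rewrite (integral_lebesgue_rV mHa (fun t => H_ge0 (t, a))).
  apply: eq_int_Rd => t; rewrite /H/= indicE mem_set ?mule1//=.
  by rewrite in_itv/= a0.
rewrite integral0_eq// => t _.
by rewrite /H/= indicE (negbTE aD) mule0.
Qed.


Let sqrt_pi_divX a : 0 < a ->
  Num.sqrt (pi / a) ^+ d = pi `^ q * a `^ (- q) :> R.
Proof.
move=> a0; rewrite -powR12_sqrt ?divr_ge0 ?pi_ge0 ?ltW//.
rewrite -powR_mulrn ?powR_ge0// -powRrM [2^-1 * _]mulrC.
rewrite powRM ?pi_ge0 ?invr_ge0 ?ltW//.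
by rewrite -[a^-1]powR_inv1 ?ltW// -powRrM mulN1r.
Qed.

Let alpha_integrandE k a : 0 < a -> alpha_integrand k a =
  expR (- a) * a `^ (s - 1) * (a + p) `^ (- q) * (a + p) ^- k.
Proof.
move=> a0; have ap0 : 0 < a + p by rewrite addr_gt0.
rewrite /alpha_integrand [(a + p) `^ (_ - q)]powRD ?(gt_eqF ap0) ?implybT//.
by rewrite powR_invn ?ltW// [_ ^- k * _]mulrC mulrA.
Qed.

(** With [c] the Gaussian constant, the terms are alpha_k g_k(z) after cancellation of Gamma(k +
    d/2) and Gamma(d/2). *)
Lemma nneseries_gauss_student (c : R) (z : 'rV[R]_d) : 0 <= c ->
  (\sum_(k <oo) (c / (k`!%:R * Gamma nu) * p ^+ k * alpha_integral k *
      ((p * sqnorm z) ^+ k * expR (- (p * sqnorm z))))%:E =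
   int_Rd (fun t : 'rV[R]_d =>
     (c * expR (- (p * sqnorm (z - t))))%:E * (student_density nu t)%:E))%E.
Proof.
move=> c_ge0; rewrite int_Rd_gauss_student//.
have N0 : 0 <= p * sqnorm z by rewrite mulr_ge0 ?sqnorm_ge0// ltW.
have Gnu := Gamma_gt0 nu0.
pose b k : R := c / (k`!%:R * Gamma nu) * p ^+ k *
  ((p * sqnorm z) ^+ k * expR (- (p * sqnorm z))).
have b0 k : 0 <= b k.
  by rewrite !mulr_ge0 ?invr_ge0 ?mulr_ge0 ?exprn_ge0 ?expR_ge0// ltW.
transitivity (\sum_(k <oo) \int[mu]_(a in `]0%R, +oo[)
    ((b k)%:E * (alpha_integrand k a)%:E))%E.
  apply: eq_eseriesr => k _; rewrite ge0_integralZl//.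
  - by rewrite alpha_integralE -EFinM mulrAC.
  - by apply/measurable_EFinP; exact: measurable_alpha_integrand.
  - move=> a /=; rewrite in_itv/= andbT => a0.
    by rewrite lee_fin ltW// alpha_integrand_gt0.
  - by rewrite lee_fin.
rewrite -integral_nneseries//; last 2 first.
- move=> k; apply: measurable_funeM.
  by apply/measurable_EFinP; exact: measurable_alpha_integrand.
- move=> k a /=; rewrite in_itv/= andbT => a0.
  by rewrite mule_ge0// lee_fin// ltW// alpha_integrand_gt0.
apply: eq_integral => a; rewrite inE/= in_itv/= andbT => a0.
have ap0 : 0 < a + p by rewrite addr_gt0.
(* The positive exponent left once exp(- p |z|^2) is taken out; p^k (p |z|^2)^k (a + p)^(-k) is its
   k-th power. *)
pose r : R := p * (p * sqnorm z) / (a + p).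
have r0 : 0 <= r by rewrite /r !mulr_ge0 ?invr_ge0 ?sqnorm_ge0 ?ltW.
pose h : R := c / Gamma nu * expR (- (p * sqnorm z)) *
  (expR (- a) * a `^ (s - 1) * (a + p) `^ (- q)).
transitivity (\sum_(k <oo) (h%:E * (r ^+ k / k`!%:R)%:E))%E.
  apply: eq_eseriesr => k _; rewrite -!EFinM alpha_integrandE//; congr EFin.
  rewrite /b /h /r invfM !exprMn exprVn.
  ring.
rewrite nneseriesZl//; last by move=> k _; rewrite lee_fin divr_ge0// exprn_ge0.
rewrite nneseries_exp// -EFinM; congr EFin; rewrite sqrt_pi_divX//.
have -> : expR (- (a * p / (a + p) * sqnorm z)) =
    expR (- (p * sqnorm z)) * expR r.
  by rewrite -expRD; congr expR; rewrite /r; field; rewrite gt_eqF.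
have c0E : c0 * pi `^ q = (Gamma nu)^-1.
  by rewrite /c0 invfM -mulrA mulVf ?mulr1// gt_eqF// powR_gt0// pi_gt0.
by rewrite /h -c0E; ring.
Qed.

Lemma measurable_student_density :
  measurable_fun setT (@student_density R d nu : rVborel R d -> R).
Proof.
apply: measurable_funM => //.
apply: (@measurableT_comp _ _ _ _ _ _ (@powR R ^~ _)) => //.
by apply: measurable_funD => //; exact: measurable_sqnorm.
Qed.

Lemma student_A_ge0 : 0 <= student_A nu d.
Proof.
have := Gamma_gt0 s0; have := Gamma_gt0 nu0 => /ltW G1 /ltW G2.
by rewrite /student_A divr_ge0// mulr_ge0// powR_ge0.
Qed.

Lemma student_density_ge0 (t : 'rV[R]_d) : 0 <= student_density nu t.
Proof.
rewrite /student_density; apply: mulr_ge0; first exact: student_A_ge0.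
exact: powR_ge0.
Qed.

Lemma student_density_le (t : 'rV[R]_d) : student_density nu t <= student_A nu d.
Proof.
rewrite /student_density ler_piMr// ?student_A_ge0//.
rewrite -[leRHS](powRr0 (1 + sqnorm t)) ler_powR//.
  by rewrite lerDl sqnorm_ge0.
by rewrite -opprD oppr_le0 ltW.
Qed.

(** The series must converge at every z, not just almost every z. Bounding the Student density by
    its constant leaves a Gaussian integral, the case a = 0 of [int_Rd_gauss_conv]. *)
Lemma int_Rd_gauss_student_lty (c : R) (z : 'rV[R]_d) : 0 <= c ->
  (int_Rd (fun t : 'rV[R]_d =>
     (c * expR (- (p * sqnorm (z - t))))%:E * (student_density nu t)%:E)
   < +oo)%E.
Proof.
move=> c_ge0.
have A0 := student_A_ge0.
have mg : measurable_fun setT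
    (fun t : rVborel R d => c * expR (- (p * sqnorm (z - (t : 'rV[R]_d))))).
  apply: measurable_funM => //.
  apply: measurableT_comp; first exact: measurable_expR.
  apply: measurableT_comp => //; apply: measurable_funM => //.
  apply: measurable_sum => i; apply: measurable_funX.
  under eq_fun do rewrite !mxE.
  by apply: measurable_funB => //; exact: measurable_coord.
pose f (t : rVborel R d) :=
  ((c * expR (- (p * sqnorm (z - (t : 'rV[R]_d)))))%:E *
  (student_density nu (t : 'rV[R]_d))%:E)%E.
pose g (t : rVborel R d) :=
  (c * expR (- (p * sqnorm (z - (t : 'rV[R]_d)))) * student_A nu d)%:E.
have mf : measurable_fun setT f.
  apply: emeasurable_funM; first exact/measurable_EFinP.
  by apply/measurable_EFinP; exact: measurable_student_density.
have mg' : measurable_fun setT g.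
  by apply/measurable_EFinP; exact: measurable_funM.
have f0 t : (0 <= f t)%E.
  by rewrite mule_ge0 ?lee_fin ?student_density_ge0// mulr_ge0 ?expR_ge0.
have g0 t : (0 <= g t)%E 
  by rewrite /g lee_fin; apply: mulr_ge0 => //; rewrite mulr_ge0 ?expR_ge0.
rewrite -(integral_lebesgue_rV mf f0).
apply: (@le_lt_trans _ _ (\int[lebesgue_rV (R := R) d]_t g t)%E).
  apply: ge0_le_integral => // t _; rewrite /f /g -EFinM lee_fin.
  by rewrite ler_wpM2l ?mulr_ge0 ?expR_ge0// student_density_le.
rewrite (integral_lebesgue_rV mg' g0).
rewrite (_ : int_Rd g = (c * student_A nu d *
   (Num.sqrt (pi / (0 + p)) ^+ d * expR (- (0 * p / (0 + p) * sqnorm z))))%:E).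
  by rewrite ltry.
rewrite -int_Rd_gauss_conv//; last exact: mulr_ge0.
apply: eq_int_Rd => t.
by rewrite /g mul0r oppr0 expR0 mulr1 mulrAC.
Qed.

Lemma nneseries_alpha :
  (\sum_(k <oo) (Gamma (k%:R + q) / (k`!%:R * Gamma q * Gamma nu) * p ^+ k *
     alpha_integral k)%:E = 1)%E.
Proof.
have Gnu := Gamma_gt0 nu0; have Gq := Gamma_gt0 q0.
pose b k : R := Gamma (k%:R + q) / (k`!%:R * Gamma q * Gamma nu) * p ^+ k.
have b0 k : 0 <= b k.
  have Gk : 0 < Gamma (k%:R + q) by rewrite Gamma_gt0// ltr_wpDl.
  by rewrite !mulr_ge0 ?invr_ge0 ?mulr_ge0 ?exprn_ge0// ltW.
transitivity (\sum_(k <oo) \int[mu]_(a in `]0%R, +oo[)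
    ((b k)%:E * (alpha_integrand k a)%:E))%E.
  apply: eq_eseriesr => k _; rewrite ge0_integralZl//.
  - by rewrite alpha_integralE.
  - by apply/measurable_EFinP; exact: measurable_alpha_integrand.
  - move=> a /=; rewrite in_itv/= andbT => a0.
    by rewrite lee_fin ltW// alpha_integrand_gt0.
  - by rewrite lee_fin.
rewrite -integral_nneseries//; last 2 first.
- move=> k; apply: measurable_funeM.
  by apply/measurable_EFinP; exact: measurable_alpha_integrand.
- move=> k a /=; rewrite in_itv/= andbT => a0.
  by rewrite mule_ge0// lee_fin// ltW// alpha_integrand_gt0.
(* What remains after summing over k is the Gamma density of parameter [nu]. *)
transitivity (\int[mu]_(a in `]0%R, +oo[)
    ((Gamma nu)^-1%:E * (a `^ (nu - 1) * expR (- a))%:E))%E; last first.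
  rewrite ge0_integralZl//.
  - by rewrite integral_Gamma// -EFinM mulVf// gt_eqF.
  - by apply/measurable_EFinP; exact: measurable_gamma_integrand.
  - by move=> a _; rewrite lee_fin mulr_ge0 ?powR_ge0 ?expR_ge0.
  - by rewrite lee_fin invr_ge0 ltW.
apply: eq_integral => a; rewrite inE/= in_itv/= andbT => a0.
have ap0 : 0 < a + p by rewrite addr_gt0.
(* Here 1 - x = a / (a + p), so (1 - x)^(-q) cancels (a + p)^(-q) and leaves a^(-q), which lowers
   the exponent s - 1 to nu - 1. *)
pose x : R := p / (a + p).
have x01 : 0 <= x < 1.
  by rewrite divr_ge0 ?ltW//= /x ltr_pdivrMr// mul1r ltrDr.
pose h : R := (Gamma q)^-1 * (Gamma nu)^-1 *
  (expR (- a) * a `^ (s - 1) * (a + p) `^ (- q)).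
transitivity (\sum_(k <oo) (h%:E * (Gamma (k%:R + q) / k`!%:R * x ^+ k)%:E))%E.
  apply: eq_eseriesr => k _; rewrite -!EFinM alpha_integrandE//; congr EFin.
  rewrite /b /h /x !invfM !exprMn exprVn.
  ring.
rewrite nneseriesZl//; last first.
  move=> k _; have Gk : 0 < Gamma (k%:R + q) by rewrite Gamma_gt0// ltr_wpDl.
  have x0 : 0 <= x by case/andP: x01.
  by rewrite lee_fin mulr_ge0 ?exprn_ge0// divr_ge0// ltW.
rewrite nneseries_negative_binomial// -!EFinM; congr EFin.
have xE : 1 - x = a / (a + p) by rewrite /x; field; rewrite gt_eqF.
have powE : (1 - x) `^ (- q) * (a + p) `^ (- q) = a `^ (- q).
  by rewrite xE -powRM ?divfK ?gt_eqF// ?divr_ge0// ltW.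
have -> : a `^ (nu - 1) = a `^ (s - 1) * a `^ (- q).
  by rewrite -powRD ?(gt_eqF a0) ?implybT//; congr powR; ring.
rewrite -powE /h; field.
by rewrite !gt_eqF.
Qed.

End mixture.

Theorem theorem1 (R : realType) (d : nat) (nu sigma : R)
    (dO : measure_display) (Omega : measurableType dO) (P : probability Omega R)
    (X T : Omega -> 'rV[R]_d) :
  (1 <= d)%N -> 0 < nu -> 0 < sigma ->
  random_vector X -> random_vector T ->
  has_density P X (fun x => (gauss_density sigma x)%:E) ->
  has_density P T (fun t => (student_density nu t)%:E) ->
  indep_rv P X T ->
  let gamma := (sigma * Num.sqrt 2)^-1 in
  let Z := fun w => X w + T w in
  (forall z : 'rV[R]_d,
     cvgn (series (fun k => alpha d nu gamma k * g_ks k sigma z))) /\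
  has_density P Z
    (fun z => (limn (series (fun k => alpha d nu gamma k * g_ks k sigma z)))%:E) /\
  (forall k, 0 < alpha d nu gamma k) /\
  series (alpha d nu gamma) @ \oo --> (1 : R).
Proof.
move=> d0 nu0 sigma0 rX rT dX dT indep gamma Z.
have gamma0 : 0 < gamma by rewrite invr_gt0 mulr_gt0// sqrtr_gt0.
pose p := gamma ^+ 2; have p0 : 0 < p by rewrite exprn_gt0.
have pE : p = (2 * sigma ^+ 2)^-1.
  by rewrite /p exprVn exprMn sqr_sqrtr// mulrC.
pose q : R := d%:R / 2; have q0 : 0 < q by rewrite divr_gt0// ltr0n.
have Gq := Gamma_gt0 q0; have Gnu := Gamma_gt0 nu0.
have Gk k : 0 < Gamma (k%:R + q) by rewrite Gamma_gt0// ltr_wpDl.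
have alphaE k : alpha d nu gamma k =
    Gamma (k%:R + q) / (k`!%:R * Gamma q * Gamma nu) * p ^+ k *
    alpha_integral d nu p k.
  by rewrite /alpha exprM.
have alpha_gt0 k : 0 < alpha d nu gamma k.
  rewrite alphaE mulr_gt0 ?alpha_integral_gt0// mulr_gt0 ?exprn_gt0//.
  have fk : 0 < (k`!%:R : R) by rewrite ltr0n fact_gt0.
  by rewrite divr_gt0// mulr_gt0// mulr_gt0.
pose c : R := (sigma * Num.sqrt (2 * pi)) ^- d.
have c0 : 0 <= c.
  by rewrite invr_ge0 exprn_ge0// mulr_ge0 ?sqrtr_ge0// ltW.
have gaussE x :
    gauss_density sigma x = c * expR (- (p * sqnorm (x : 'rV[R]_d))).
  by rewrite /gauss_density pE [sqnorm x / _]mulrC.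
have termE k z : alpha d nu gamma k * g_ks k sigma (z : 'rV[R]_d) =
    c / (k`!%:R * Gamma nu) * p ^+ k * alpha_integral d nu p k *
    ((p * sqnorm z) ^+ k * expR (- (p * sqnorm z))).
  rewrite alphaE /g_ks [sqnorm z / _]mulrC -pE -/q.
  rewrite [(Gamma (k%:R + q) * _)^-1]invfM -/c.
  have fk : (k`!%:R : R) != 0 by rewrite pnatr_eq0 -lt0n fact_gt0.
  have cancelGamma (G K Q N I m e pk : R) :
      G != 0 -> K != 0 -> Q != 0 -> N != 0 ->
      G / (K * Q * N) * pk * I * (Q * (G^-1 * c) * m * e) =
      c / (K * N) * pk * I * (m * e).
    by move=> G0 K0 Q0 N0; field; rewrite G0 K0 Q0 N0.
  by apply: cancelGamma => //; rewrite gt_eqF.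
have term_ge0 z k : 0 <= alpha d nu gamma k * g_ks k sigma (z : 'rV[R]_d).
  have pN0 : 0 <= p * sqnorm z := mulr_ge0 (ltW p0) (sqnorm_ge0 z).
  have cG0 : 0 <= c / (k`!%:R * Gamma nu).
    by apply: divr_ge0 => //; apply: mulr_ge0 => //; exact: ltW.
  have I0 : 0 <= alpha_integral d nu p k by apply/ltW/alpha_integral_gt0.
  rewrite termE; apply: mulr_ge0; last by rewrite mulr_ge0 ?exprn_ge0 ?expR_ge0.
  by apply: mulr_ge0 => //; apply: mulr_ge0 => //; rewrite exprn_ge0 // ltW.
pose fZ z : \bar R := int_Rd (fun t : 'rV[R]_d =>
  ((gauss_density sigma (z - t))%:E * (student_density nu t)%:E)%E).
have fZE z : fZ z = int_Rd (fun t : 'rV[R]_d =>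
    ((c * expR (- (p * sqnorm (z - t))))%:E * (student_density nu t)%:E)%E).
  by apply: eq_int_Rd => t; rewrite gaussE.
have fZ_ge0 z : (0 <= fZ z)%E.
  rewrite fZE; apply: int_Rd_ge0 => t.
  by rewrite mule_ge0 ?lee_fin ?student_density_ge0// mulr_ge0 ?expR_ge0.
(* Without finiteness, neither [fine] nor the real [limn] would determine the convolution
   density. *)
have fZ_fin z : fZ z \is a fin_num.
  by rewrite ge0_fin_numE// fZE int_Rd_gauss_student_lty.
have cvg_term z :
    series (fun k => alpha d nu gamma k * g_ks k sigma z) @ \oo -->
    fine (fZ z).
  apply: cvg_series_EFin => //; rewrite fineK// fZE -nneseries_gauss_student//.
  by apply: eq_eseriesr => k _; rewrite termE.
split; first by move=> z; apply/cvg_ex; exists (fine (fZ z)).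
split; last first.
  split=> //; apply: cvg_series_EFin => [k|]; first exact: ltW.
  rewrite -(nneseries_alpha d0 nu0 p0).
  by apply: eq_eseriesr => k _; rewrite alphaE.
have mG : measurable_fun setT
    (fun x : rVborel R d => (gauss_density sigma (x : 'rV[R]_d))%:E).
  apply/measurable_EFinP; apply: measurable_funM => //.
  apply: measurableT_comp; first exact: measurable_expR.
  apply: measurableT_comp => //; apply: measurable_funM => //.
  exact: measurable_sqnorm.
have mT : measurable_fun setT
    (fun x : rVborel R d => (student_density nu (x : 'rV[R]_d))%:E).
  by apply/measurable_EFinP; exact: measurable_student_density.
have G_ge0 (x : rVborel R d) : (0 <= (gauss_density sigma (x : 'rV[R]_d))%:E)%E.
  by rewrite lee_fin gaussE mulr_ge0 ?expR_ge0.
have T_ge0 (x : rVborel R d) : (0 <= (student_density nu (x : 'rV[R]_d))%:E)%E.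
  by rewrite lee_fin student_density_ge0.
have dZ := density_convolution mG G_ge0 mT T_ge0 rX rT dX dT indep.
move=> A mA; rewrite (dZ A mA); apply: eq_int_Rd => z.
congr (_ * _)%E; rewrite (cvg_lim _ (cvg_term z))//.
by rewrite fineK.
Qed.
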